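(* There exist boundary data $A_1,B_1,A_2,B_2,\phi_A,\phi_B\in\mathbb{R}$ with $A_1=-B_1$, $A_2=B_2>0$, $\phi_A=-\phi_B$ such that the Dirichlet problem for elasticae with data $(A_1,A_2),(B_1,B_2),\phi_A,\phi_B$ has uncountably many nonsymmetric solutions.
   Context: Let $\mathbb{H}=\{(x_1,x_2)\in\mathbb{R}^2: x_2>0\}$ with the hyperbolic metric $(dx_1^2+dx_2^2)/x_2^2$. A smooth curve $\gamma=(\gamma_1,\gamma_2)$ in $\mathbb{H}$ is parametrized by hyperbolic arclength if $(\gamma_1')^2+(\gamma_2')^2=\gamma_2^2$. Its angle function $\phi$ is the smooth function (unique up to adding a constant in $2\pi\mathbb{Z}$) with $\gamma_1'=\gamma_2\cos(\phi)$, $\gamma_2'=\gamma_2\sin(\phi)$, and its hyperbolic curvature function is $\kappa=\phi'+\cos(\phi)$. The curve $\gamma$ is an elastica (a critical point of $\int\kappa^2\,ds$) if $-\kappa''+\kappa=\frac12\kappa^3$; this is equivalent to the surface of revolution $\Sigma_\gamma=\{(\gamma_1(s),\gamma_2(s)\cos t,\gamma_2(s)\sin t)\}$ being a Willmore surface, i.e. $\mathcal{W}'(\Sigma_\gamma)=0$. Curves need not be simple and need not be graphs. A solution of the Dirichlet problem with data $(A_1,A_2),(B_1,B_2)\in\mathbb{H}$, $\phi_A,\phi_B\in\mathbb{R}$ is an elastica $\gamma:[0,L]\to\mathbb{H}$ parametrized by hyperbolic arclength, with (unknown) hyperbolic length $L>0$, such that $$\gamma(0)=(A_1,A_2),\quad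 \gamma(L)=(B_1,B_2),\quad e^{i\phi(0)}=e^{i\phi_A},\quad e^{i\phi(L)}=e^{i\phi_B}.$$ A solution is called symmetric if $\gamma_1(L/2+s)=-\gamma_1(L/2-s)$ and $\gamma_2(L/2+s)=\gamma_2(L/2-s)$ for all $s\in[0,L/2]$, and nonsymmetric otherwise. *)

(* Defs.v *)
(* Stdlib reals with Coquelicot derivatives. *)
From Stdlib Require Export Reals.
From Coquelicot Require Export Coquelicot.
Open Scope R_scope.

Definition Icc (L : R) : Type := {s : R | 0 <= s <= L}.

(* The length belongs to the curve, and the domain is exactly [0, len]: two
   curves cannot differ merely by irrelevant values outside the interval. *)
Record curve : Type := Curve {
  len : R;
  pos : Icc len -> R * R
}.

(* A function is smooth on [0, L] when it is the restriction of a smooth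
   function on R; the derivatives of such an extension at points of [0, L],
   endpoints included, are determined by the restriction when 0 < L. *)
Definition smooth (f : R -> R) : Prop :=
  forall (n : nat) (x : R), ex_derive_n f n x.

Definition smooth_extension (c : curve) (g1 g2 : R -> R) : Prop :=
  smooth g1 /\ smooth g2 /\
  forall s : Icc (len c), pos c s = (g1 (proj1_sig s), g2 (proj1_sig s)).

Definition upper_half_plane (p : R * R) : Prop := 0 < snd p.

Definition hyperbolic_arclength (L : R) (g1 g2 : R -> R) : Prop :=
  forall s, 0 <= s <= L -> Derive g1 s ^ 2 + Derive g2 s ^ 2 = g2 s ^ 2.

Definition angle_function (L : R) (g1 g2 phi : R -> R) : Prop :=
  smooth phi /\
  forall s, 0 <= s <= L ->
    Derive g1 s = g2 s * cos (phi s) /\ Derive g2 s = g2 s * sin (phi s).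

Definition hyperbolic_curvature (phi : R -> R) (s : R) : R :=
  Derive phi s + cos (phi s).

Definition elastica_equation (L : R) (kappa : R -> R) : Prop :=
  forall s, 0 <= s <= L ->
    - Derive_n kappa 2 s + kappa s = / 2 * kappa s ^ 3.

(* e^(i t) *)
Definition expi (t : R) : C := (cos t, sin t).

(* The angle function is unique up to a constant in 2 pi Z, so quantifying it
   existentially is harmless. *)
Definition dirichlet_solution (A B : R * R) (phiA phiB : R) (c : curve) : Prop :=
  0 < len c /\
  (forall s : Icc (len c), upper_half_plane (pos c s)) /\
  exists g1 g2 phi : R -> R,
    smooth_extension c g1 g2 /\
    hyperbolic_arclength (len c) g1 g2 /\
    angle_function (len c) g1 g2 phi /\
    elastica_equation (len c) (hyperbolic_curvature phi) /\
    (g1 0, g2 0) = A /\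
    (g1 (len c), g2 (len c)) = B /\
    expi (phi 0) = expi phiA /\
    expi (phi (len c)) = expi phiB.

Definition symmetric_curve (c : curve) : Prop :=
  forall (s : R) (p q : Icc (len c)),
    0 <= s <= len c / 2 ->
    proj1_sig p = len c / 2 + s ->
    proj1_sig q = len c / 2 - s ->
    fst (pos c p) = - fst (pos c q) /\ snd (pos c p) = snd (pos c q).

Definition countable {T : Type} (S : T -> Prop) : Prop :=
  exists f : T -> nat, forall x y, S x -> S y -> f x = f y -> x = y.

(* Main.v *)
Require Import Defs.
From Stdlib Require Import List Lra Psatz ClassicalEpsilon.

(** A closed elastica of nonconstant curvature gives the family: starting it
    at any of its points and moving that point, by an orientation preserving
    isometry, to (0, 1) with horizontal tangent, one gets a solution with both
    end points at (0, 1) and both angles 0.  Different starting points on an arc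
    where the curvature is strictly monotone give different curves, and none of
    them is symmetric since the derivative of the curvature does not vanish at
    the starting point.

    For the closed elastica take 0 < q < 1, c = sqrt (1 - q^2) and
    kappa = sqrt (2 (1 + q cos psi)) with psi' = kappa.  Then
    kappa'' = kappa - kappa^3 / 2, and over a period of psi the curve turns
    around a fixed point of the hyperbolic plane by the angle
    PI + 1/2 int_0^(2 PI) c / (kappa + c) dpsi.  This equals sqrt 2 * PI at
    q = 0 and tends to PI as q tends to 1, so it is 4 PI / 3 for some q, and
    the elastica closes up after three periods of its curvature. *)

(** * Tools from real analysis *)

(** Cantor's nested intervals: stage [n] keeps a closed outer third that avoids [u n], and the
    supremum of the left ends lies in every stage. *)
Lemma sequence_misses_point (u : nat -> R) (a b : R) :
  a < b -> exists x, a <= x <= b /\ forall n, u n <> x.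
Proof.
intros Hab.
pose (step := fun (n : nat) (p : R * R) =>
  let (l, r) := p in
  if Rle_dec (u n) (l + (r - l) / 3) then (l + 2 * (r - l) / 3, r)
  else (l, l + (r - l) / 3)).
pose (I := fix I n := match n with O => (a, b) | S m => step m (I m) end).
assert (Hstep : forall n, fst (I n) < snd (I n) ->
  fst (I n) <= fst (I (S n)) /\ fst (I (S n)) < snd (I (S n)) /\
  snd (I (S n)) <= snd (I n) /\ ~ (fst (I (S n)) <= u n <= snd (I (S n)))).
{ intros n; simpl; destruct (I n) as [l r]; simpl.
  destruct (Rle_dec (u n) (l + (r - l) / 3)); simpl; intros; repeat split; lra. }
assert (Hlt : forall n, fst (I n) < snd (I n)).
{ intros n; induction n; [exact Hab | apply Hstep, IHn]. }
assert (Hmono : forall n m, fst (I n) <= fst (I (n + m)%nat) /\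
  snd (I (n + m)%nat) <= snd (I n)).
{ intros n m; induction m as [|m IH].
  - rewrite Nat.add_0_r; lra.
  - rewrite Nat.add_succ_r. destruct (Hstep (n + m)%nat (Hlt _)); lra. }
assert (Hlr : forall n m, fst (I n) <= snd (I m)).
{ intros n m.
  generalize (Hmono n m) (Hmono m n) (Hlt (n + m)%nat).
  rewrite (Nat.add_comm m n); lra. }
destruct (completeness (fun x => exists n, x = fst (I n))) as [x [Hub Hlub]].
- exists b; intros y [n ->]; exact (Hlr n O).
- exists a, O; reflexivity.
- assert (Hx : forall n, fst (I n) <= x <= snd (I n)).
  { intros n; split; [apply Hub; exists n; reflexivity|].
    apply Hlub; intros y [m ->]; apply Hlr. }
  exists x; split; [exact (Hx O)|].
  intros n Hn; destruct (Hstep n (Hlt n)) as (_ & _ & _ & H).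
  apply H; rewrite Hn; apply Hx.
Qed.

(* Smoothness of everything in sight follows from first derivatives alone, once
   finitely many functions have derivatives polynomial in each other. *)
Inductive algebra (G : (R -> R) -> Prop) : (R -> R) -> Prop :=
| alg_gen g : G g -> algebra G g
| alg_const a : algebra G (fun _ => a)
| alg_plus f g : algebra G f -> algebra G g -> algebra G (fun x => f x + g x)
| alg_mult f g : algebra G f -> algebra G g -> algebra G (fun x => f x * g x).

(** Leibniz's rule extends closure under differentiation from the generators to the whole algebra,
    so iterated derivatives never leave it. *)
Lemma algebra_smooth (G : (R -> R) -> Prop) :
  (forall g, G g -> exists dg, algebra G dg /\ forall x, is_derive g x (dg x)) ->
  forall f, algebra G f -> smooth f.
Proof.
intros HG.
assert (H1 : forall f, algebra G f ->
  exists df, algebra G df /\ forall x, is_derive f x (df x)).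
{ intros f Hf; induction Hf as [g Hg|a|f g Hf [df [Df HDf]] Hg [dg [Dg HDg]]
                               |f g Hf [df [Df HDf]] Hg [dg [Dg HDg]]].
  - exact (HG g Hg).
  - exists (fun _ => 0); split; [apply alg_const|]. intros x; apply @is_derive_const.
  - exists (fun x => df x + dg x); split; [now apply alg_plus|].
    intros x; exact (is_derive_plus f g x _ _ (HDf x) (HDg x)).
  - exists (fun x => df x * g x + f x * dg x); split.
    + apply alg_plus; apply alg_mult; assumption.
    + intros x; exact (is_derive_mult f g x _ _ (HDf x) (HDg x) Rmult_comm). }
assert (Hn : forall n f, algebra G f ->
  exists fn, algebra G fn /\ forall x, Derive_n f n x = fn x).
{ intros n f Hf; induction n as [|n [fn [Afn Efn]]].
  - exists f; split; [exact Hf | reflexivity].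
  - destruct (H1 fn Afn) as [dfn [Adfn Hdfn]].
    exists dfn; split; [exact Adfn|]. intros x; simpl.
    rewrite (Derive_ext _ fn x Efn). apply is_derive_unique, Hdfn. }
intros f Hf [|n] x; [exact I|]; simpl.
destruct (Hn n f Hf) as [fn [Afn Efn]].
destruct (H1 fn Afn) as [dfn [_ Hdfn]].
apply (ex_derive_ext fn); [intros t; symmetry; apply Efn|].
exists (dfn x); apply Hdfn.
Qed.

Lemma is_derive_zero_const (f : R -> R) :
  (forall x, is_derive f x 0) -> forall x y, f x = f y.
Proof.
intros Hf x y. destruct (MVT_gen f x y (fun _ => 0)) as [c [_ Hc]].
- intros; apply Hf.
- intros t _; apply continuity_pt_filterlim, (ex_derive_continuous f t).
  exists 0; apply Hf.
- lra.
Qed.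

(** At each point, end points included, some arbitrarily small step stays in the interval, and its
    difference quotient is 0. Thus values of a curve on [[0, L]] alone fix derivatives at 0. *)
Lemma is_derive_zero_on_interval (f df : R -> R) (L : R) :
  0 < L -> (forall s, is_derive f s (df s)) ->
  (forall s, 0 <= s <= L -> f s = 0) -> forall s, 0 <= s <= L -> df s = 0.
Proof.
intros HL Hd H0 s Hs.
destruct (Req_dec (df s) 0) as [E|E]; [exact E|exfalso].
assert (HD := proj1 (is_derive_Reals f s (df s)) (Hd s)).
assert (He : 0 < Rabs (df s)) by now apply Rabs_pos_lt.
destruct (HD _ He) as [[d Hdp] Hlim]; simpl in Hlim.
assert (exists h, h <> 0 /\ Rabs h < d /\ 0 <= s + h <= L) as (h & Hh & Hhd & Hsh).
{ pose (m := Rmin d L / 4).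
  assert (0 < Rmin d L) by (apply Rmin_glb_lt; assumption).
  assert (Rmin d L <= d) by apply Rmin_l. assert (Rmin d L <= L) by apply Rmin_r.
  destruct (Rle_dec s (L / 2)); [exists m | exists (- m)]; unfold m in *;
    (split; [lra|split; [apply Rabs_def1; lra | lra]]). }
specialize (Hlim h Hh Hhd). rewrite (H0 _ Hsh), (H0 _ Hs) in Hlim.
replace ((0 - 0) / h - df s) with (- df s) in Hlim by (field; exact Hh).
rewrite Rabs_Ropp in Hlim; lra.
Qed.

(** * Frames in SL(2, R) and the elasticae they generate *)

(* Rows of a frame in SL(2, R): when (a, b) and (c, d) are frame rows for K with
   ad - bc = 1, the curve (a i + b) / (c i + d) has hyperbolic speed 1 and
   curvature K, and its angle phi satisfies e^(i phi) = (d - i c)^2 / (c^2 + d^2). *)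
Definition frame_row (K f g : R -> R) : Prop :=
  forall s, is_derive f s ((1 - K s) / 2 * g s) /\
            is_derive g s ((1 + K s) / 2 * f s).

Lemma Derive_eta (f : R -> R) (s l : R) :
  is_derive f s l -> Derive (fun t => f t) s = l.
Proof. apply is_derive_unique. Qed.

Lemma frame_row_ex (K f g : R -> R) :
  frame_row K f g -> forall s, ex_derive f s /\ ex_derive g s.
Proof. intros H s; destruct (H s); split; eexists; eassumption. Qed.

Lemma frame_row_Derive (K f g : R -> R) : frame_row K f g ->
  forall s, Derive (fun x => f x) s = (1 - K s) / 2 * g s /\
            Derive (fun x => g x) s = (1 + K s) / 2 * f s.
Proof. intros H s; destruct (H s); split; apply is_derive_unique; assumption. Qed.

Lemma frame_row_comb (K f g f' g' : R -> R) (u v : R) :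
  frame_row K f g -> frame_row K f' g' ->
  frame_row K (fun s => u * f s + v * f' s) (fun s => u * g s + v * g' s).
Proof.
intros H H' s.
destruct (frame_row_ex _ _ _ H s), (frame_row_ex _ _ _ H' s).
destruct (frame_row_Derive _ _ _ H s) as [E1 E2].
destruct (frame_row_Derive _ _ _ H' s) as [E3 E4].
split; (auto_derive; [tauto | rewrite ?E1, ?E2, ?E3, ?E4; ring]).
Qed.

Lemma is_derive_shift (f df : R -> R) (t : R) :
  (forall s, is_derive f s (df s)) ->
  forall s, is_derive (fun x => f (t + x)) s (df (t + s)).
Proof.
intros H s. assert (E : Derive (fun x => f x) (t + s) = df (t + s))
  by apply is_derive_unique, H.
auto_derive; [exists (df (t + s)); apply H | rewrite E; ring].
Qed.

Lemma frame_row_shift (K f g : R -> R) (t : R) : frame_row K f g ->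
  frame_row (fun s => K (t + s)) (fun s => f (t + s)) (fun s => g (t + s)).
Proof.
intros H s; split.
- apply (is_derive_shift f (fun s => (1 - K s) / 2 * g s)); apply H.
- apply (is_derive_shift g (fun s => (1 + K s) / 2 * f s)); apply H.
Qed.

(** The coefficient matrix of the frame system has zero trace, so the Wronskian of two rows is
    constant. *)
Lemma frame_det_const (K a b c d : R -> R) :
  frame_row K a b -> frame_row K c d ->
  forall s t, a s * d s - b s * c s = a t * d t - b t * c t.
Proof.
intros H H' s t.
apply (is_derive_zero_const (fun s => a s * d s - b s * c s)); clear s t; intros s.
destruct (frame_row_ex _ _ _ H s), (frame_row_ex _ _ _ H' s).
destruct (frame_row_Derive _ _ _ H s) as [E1 E2].
destruct (frame_row_Derive _ _ _ H' s) as [E3 E4].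
auto_derive; [tauto | rewrite E1, E2, E3, E4; field].
Qed.

(** Real and imaginary parts of [(a i + b) / (c i + d)], the latter simplified by [ad - bc = 1]. *)
Definition frame_curve (L : R) (a b c d : R -> R) : curve :=
  Curve L (fun s => let s := proj1_sig s in
    ((a s * c s + b s * d s) * / (c s * c s + d s * d s),
     / (c s * c s + d s * d s))).

Local Ltac alg := first [ assumption | apply alg_const | apply alg_plus; alg
                  | apply alg_mult; alg ].

(** An identity frame at both ends puts them at [i] with horizontal tangent. The angle is rebuilt by
    integration from its candidate cosine and sine. *)
Lemma frame_curve_dirichlet (L : R) (K K1 a b c d : R -> R) :
  0 < L ->
  (forall s, is_derive K s (K1 s)) ->
  (forall s, is_derive K1 s (K s - K s ^ 3 / 2)) ->
  frame_row K a b -> frame_row K c d ->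
  (forall s, s = 0 \/ s = L -> a s = 1 /\ b s = 0 /\ c s = 0 /\ d s = 1) ->
  dirichlet_solution (0, 1) (0, 1) 0 0 (frame_curve L a b c d).
Proof.
intros HL HK HK1 Hab Hcd Hend.
destruct (Hend 0 (or_introl eq_refl)) as (a0 & b0 & c0 & d0).
destruct (Hend L (or_intror eq_refl)) as (aL & bL & cL & dL).
assert (Hdet : forall s, a s * d s - b s * c s = 1).
{ intros s; rewrite (frame_det_const K a b c d Hab Hcd s 0), a0, b0, c0, d0; ring. }
assert (HP : forall s, 0 < c s * c s + d s * d s).
{ intros s; specialize (Hdet s).
  destruct (Req_dec (c s) 0) as [E|E]; [|nra].
  assert (d s <> 0) by (intros E'; rewrite E, E' in Hdet; lra). nra. }
assert (Dc : forall s, is_derive c s ((1 - K s) / 2 * d s)) by apply Hcd.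
assert (Dd : forall s, is_derive d s ((1 + K s) / 2 * c s)) by apply Hcd.
assert (Da : forall s, is_derive a s ((1 - K s) / 2 * b s)) by apply Hab.
assert (Db : forall s, is_derive b s ((1 + K s) / 2 * a s)) by apply Hab.
pose (y := fun s => / (c s * c s + d s * d s)).
(* [co] and [si] are the real and imaginary parts of [(d - i c)^2 / (c^2 + d^2)]. *)
pose (co := fun s => (d s * d s - c s * c s) * y s).
pose (si := fun s => - 2 * c s * d s * y s).
pose (x := fun s => (a s * c s + b s * d s) * y s).
Local Ltac exd := repeat split; eexists; eauto.
assert (Dy : forall s, is_derive y s (y s * si s)).
{ intros s; unfold y, si, y. specialize (HP s).
  auto_derive; [repeat split; try (eexists; eauto); lra|].
  rewrite (Derive_eta _ _ _ (Dc s)), (Derive_eta _ _ _ (Dd s)).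
  field; lra. }
assert (Hy : forall s, (c s * c s + d s * d s) * y s = 1).
{ intros s; unfold y; apply Rinv_r; specialize (HP s); lra. }
assert (Dco : forall s, is_derive co s (- si s * (K s - co s))).
{ intros s; unfold co. auto_derive; [exd|].
  rewrite (Derive_eta _ _ _ (Dc s)), (Derive_eta _ _ _ (Dd s)),
    (Derive_eta _ _ _ (Dy s)); unfold si, co.
  field. }
assert (Dsi : forall s, is_derive si s (co s * (K s - co s))).
{ intros s; unfold si. auto_derive; [exd|].
  rewrite (Derive_eta _ _ _ (Dc s)), (Derive_eta _ _ _ (Dd s)),
    (Derive_eta _ _ _ (Dy s)); unfold si, co.
  assert (E : y s * (c s * c s + d s * d s) = 1) by (rewrite Rmult_comm; apply Hy).
  (* The quantity [(c^2 + d^2) y], equal to 1, is squared so that its difference with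
     [4 c^2 d^2 y^2] becomes [- co^2]. *)
  transitivity (K s * (d s * d s - c s * c s) * y s
    + 4 * c s * c s * d s * d s * y s * y s
    - (c s * c s + d s * d s) * y s * (y s * (c s * c s + d s * d s))).
  - rewrite E; field.
  - field. }
assert (Dx : forall s, is_derive x s (y s * co s)).
{ intros s; unfold x. auto_derive; [exd|].
  rewrite (Derive_eta _ _ _ (Dc s)), (Derive_eta _ _ _ (Dd s)),
    (Derive_eta _ _ _ (Da s)), (Derive_eta _ _ _ (Db s)),
    (Derive_eta _ _ _ (Dy s)); unfold si, co.
  transitivity (((a s * d s + b s * c s) * ((c s * c s + d s * d s) * y s)
     - 2 * (a s * c s + b s * d s) * c s * d s * y s) * y s).
  - rewrite Hy; field.
  - transitivity ((a s * d s - b s * c s) * (d s * d s - c s * c s) * y s * y s);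
      [ring | rewrite Hdet; ring]. }
(* Curvature [K] forces [phi' = K - cos phi]. *)
pose (phi := fun s => RInt (fun t => K t - co t) 0 s).
assert (Hcont : forall s, continuous (fun t => K t - co t) s).
{ intros s; apply @ex_derive_continuous; auto_derive; exd. }
assert (Dphi : forall s, is_derive phi s (K s - co s)).
{ intros s; apply (is_derive_RInt (fun t => K t - co t) phi 0); [|apply Hcont].
  apply filter_forall; intros t; apply (@RInt_correct R_CompleteNormedModule).
  apply @ex_RInt_continuous; intros; apply Hcont. }
assert (phi0 : phi 0 = 0) by apply (@RInt_point R_CompleteNormedModule).
assert (co0 : co 0 = 1) by (unfold co, y; rewrite c0, d0; field).
assert (si0 : si 0 = 0) by (unfold si, y; rewrite c0, d0; field).
(* [(co, si)] and [(cos phi, sin phi)] start at [(1, 0)] and rotate at the same rate [K - co], so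
   their dot product stays 1 and their cross product 0. *)
assert (HN : forall s, co s * cos (phi s) + si s * sin (phi s) = 1).
{ intros s.
  rewrite (is_derive_zero_const
    (fun s => co s * cos (phi s) + si s * sin (phi s))) with (y := 0).
  - rewrite phi0, cos_0, sin_0, co0, si0; ring.
  - clear s; intros s; auto_derive; [exd|].
    rewrite (Derive_eta _ _ _ (Dco s)), (Derive_eta _ _ _ (Dsi s)),
      (Derive_eta _ _ _ (Dphi s)); ring. }
assert (HM : forall s, co s * sin (phi s) - si s * cos (phi s) = 0).
{ intros s.
  rewrite (is_derive_zero_const
    (fun s => co s * sin (phi s) - si s * cos (phi s))) with (y := 0).
  - rewrite phi0, cos_0, sin_0, co0, si0; ring.
  - clear s; intros s; auto_derive; [exd|].
    rewrite (Derive_eta _ _ _ (Dco s)), (Derive_eta _ _ _ (Dsi s)),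
      (Derive_eta _ _ _ (Dphi s)); ring. }
assert (Hcs : forall t, cos t * cos t = 1 - sin t * sin t).
{ intros t; generalize (sin2_cos2 t); unfold Rsqr; lra. }
assert (Hcos : forall s, cos (phi s) = co s).
{ intros s.
  transitivity ((co s * cos (phi s) + si s * sin (phi s)) * cos (phi s)
    + (co s * sin (phi s) - si s * cos (phi s)) * sin (phi s)).
  - rewrite HN, HM; ring.
  - transitivity (co s * (cos (phi s) * cos (phi s) + sin (phi s) * sin (phi s)));
      [ring | rewrite Hcs; ring]. }
assert (Hsin : forall s, sin (phi s) = si s).
{ intros s.
  transitivity ((co s * cos (phi s) + si s * sin (phi s)) * sin (phi s)
    - (co s * sin (phi s) - si s * cos (phi s)) * cos (phi s)).
  - rewrite HN, HM; ring.
  - transitivity (si s * (cos (phi s) * cos (phi s) + sin (phi s) * sin (phi s)));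
      [ring | rewrite Hcs; ring]. }
pose (G := fun f => In f (K :: K1 :: a :: b :: c :: d :: y :: phi :: nil)).
assert (Gin : forall f, G f -> algebra G f) by (intros; now apply alg_gen).
assert (AK : algebra G K) by (apply Gin; unfold G; simpl; tauto).
assert (AK1 : algebra G K1) by (apply Gin; unfold G; simpl; tauto).
assert (Aa : algebra G a) by (apply Gin; unfold G; simpl; tauto).
assert (Ab : algebra G b) by (apply Gin; unfold G; simpl; tauto).
assert (Ac : algebra G c) by (apply Gin; unfold G; simpl; tauto).
assert (Ad : algebra G d) by (apply Gin; unfold G; simpl; tauto).
assert (Ay : algebra G y) by (apply Gin; unfold G; simpl; tauto).
assert (Aphi : algebra G phi) by (apply Gin; unfold G; simpl; tauto).
assert (Hsm : forall f, algebra G f -> smooth f).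
{ apply algebra_smooth. intros g Hg; unfold G in Hg; simpl in Hg.
  destruct Hg as [<-|[<-|[<-|[<-|[<-|[<-|[<-|[<-|[]]]]]]]]].
  - exists K1; split; assumption.
  - exists (fun s => K s + - / 2 * (K s * (K s * K s))); split; [alg|].
    intros s; evar_last; [apply HK1 | field].
  - exists (fun s => (/ 2 + - / 2 * K s) * b s); split; [alg|].
    intros s; evar_last; [apply Da | field].
  - exists (fun s => (/ 2 + / 2 * K s) * a s); split; [alg|].
    intros s; evar_last; [apply Db | field].
  - exists (fun s => (/ 2 + - / 2 * K s) * d s); split; [alg|].
    intros s; evar_last; [apply Dc | field].
  - exists (fun s => (/ 2 + / 2 * K s) * c s); split; [alg|].
    intros s; evar_last; [apply Dd | field].
  - exists (fun s => y s * (-2 * c s * d s * y s)); split; [alg|].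
    intros s; apply Dy.
  - exists (fun s => K s + -1 * ((d s * d s + -1 * (c s * c s)) * y s)); split; [alg|].
    intros s; evar_last; [apply Dphi | unfold co; ring]. }
assert (Hkappa : forall s, hyperbolic_curvature phi s = K s).
{ intros s; unfold hyperbolic_curvature.
  rewrite (is_derive_unique _ _ _ (Dphi s)), Hcos; ring. }
split; [exact HL|split].
{ intros s; unfold upper_half_plane; simpl; apply Rinv_0_lt_compat, HP. }
exists x, y, phi.
split; [split; [|split]|].
- apply Hsm; unfold x; alg.
- apply Hsm; assumption.
- intros s; reflexivity.
- assert (Hsp : forall s, Derive x s = y s * cos (phi s) /\ Derive y s = y s * sin (phi s)).
  { intros s; rewrite Hcos, Hsin.
    split; apply is_derive_unique; [apply Dx | apply Dy]. }
  assert (HphiL : cos (phi L) = 1 /\ sin (phi L) = 0).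
  { rewrite Hcos, Hsin; unfold co, si, y; rewrite cL, dL; split; field. }
  split; [|split; [|split; [|split; [|split; [|split]]]]].
  + intros s _. destruct (Hsp s) as [-> ->].
    transitivity (y s ^ 2 * (cos (phi s) * cos (phi s) + sin (phi s) * sin (phi s)));
      [ring | rewrite Hcs; ring].
  + split; [apply Hsm; assumption | intros s _; apply Hsp].
  + intros s _. rewrite Hkappa, (Derive_n_ext _ K 2 s Hkappa); simpl.
    rewrite (Derive_ext (fun t => Derive (fun u => K u) t) K1).
    * rewrite (is_derive_unique _ _ _ (HK1 s)); field.
    * intros t; apply Derive_eta, HK.
  + unfold x, y; rewrite a0, b0, c0, d0; f_equal; field.
  + unfold x, y; simpl; rewrite aL, bL, cL, dL; f_equal; field.
  + now rewrite phi0.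
  + unfold expi; simpl; destruct HphiL as [-> ->]; now rewrite cos_0, sin_0.
Qed.

(** * Reading the curvature off the height *)

Section FrameNorm.

Variables (K K1 c d : R -> R).
Hypothesis HK : forall s, is_derive K s (K1 s).
Hypothesis Hcd : frame_row K c d.

(** The reciprocal of the height, followed by its first three derivatives. Where [c = 0] and
    [d = 1], the second is [1 - K] and the third is [- K1]. *)
Definition frame_norm s := c s * c s + d s * d s.
Definition frame_norm1 s := 2 * c s * d s.
Definition frame_norm2 s := (1 - K s) * (d s * d s) + (1 + K s) * (c s * c s).
Definition frame_norm3 s :=
  K1 s * (c s * c s - d s * d s) + 2 * (1 - K s * K s) * c s * d s.

Lemma frame_norm_derive s :
  is_derive frame_norm s (frame_norm1 s) /\
  is_derive frame_norm1 s (frame_norm2 s) /\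
  is_derive frame_norm2 s (frame_norm3 s).
Proof.
destruct (frame_row_ex _ _ _ Hcd s) as [X1 X2].
destruct (frame_row_Derive _ _ _ Hcd s) as [E1 E2].
assert (X3 : ex_derive K s) by (eexists; apply HK).
assert (E3 := Derive_eta _ _ _ (HK s)).
unfold frame_norm, frame_norm1, frame_norm2, frame_norm3.
split; [|split]; (auto_derive; [tauto | rewrite ?E1, ?E2, ?E3; field]).
Qed.

End FrameNorm.

(** A total function of a curve and a real, so that equality of curves transfers by [f_equal]
    despite the dependent domain; 0 is a default outside [[0, len c]]. *)
Definition height (c : curve) (s : R) : R :=
  match Rle_dec 0 s, Rle_dec s (len c) with
  | left h, left h' => snd (pos c (exist _ s (conj h h')))
  | _, _ => 0
  end.

Lemma height_frame_curve (L : R) (a b c d : R -> R) (s : R) :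
  0 <= s <= L -> height (frame_curve L a b c d) s = / frame_norm c d s.
Proof.
intros Hs; unfold height; simpl.
destruct (Rle_dec 0 s); [|lra]. destruct (Rle_dec s L); [reflexivity | lra].
Qed.

(** Equal curves have equal reciprocal heights, hence equal second derivatives [1 - K 0] and
    [1 - K' 0] at the start. *)
Lemma frame_curve_curvature (L : R) (K K1 a b c d K' K1' a' b' c' d' : R -> R) :
  0 < L ->
  (forall s, is_derive K s (K1 s)) -> (forall s, is_derive K' s (K1' s)) ->
  frame_row K c d -> frame_row K' c' d' ->
  c 0 = 0 -> d 0 = 1 -> c' 0 = 0 -> d' 0 = 1 ->
  frame_curve L a b c d = frame_curve L a' b' c' d' -> K 0 = K' 0.
Proof.
intros HL HK HK' H H' c0 d0 c0' d0' E.
assert (HD := fun s => frame_norm_derive K K1 c d HK H s).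
assert (HD' := fun s => frame_norm_derive K' K1' c' d' HK' H' s).
assert (E0 : forall s, 0 <= s <= L -> frame_norm c d s - frame_norm c' d' s = 0).
{ intros s Hs. apply (f_equal (fun c => / height c s)) in E.
  rewrite !height_frame_curve, !Rinv_inv in E by exact Hs. lra. }
assert (E1 := is_derive_zero_on_interval
  (fun s => frame_norm c d s - frame_norm c' d' s)
  (fun s => frame_norm1 c d s - frame_norm1 c' d' s) L HL
  (fun s => is_derive_minus _ _ s _ _ (proj1 (HD s)) (proj1 (HD' s))) E0).
assert (E2 := is_derive_zero_on_interval _
  (fun s => frame_norm2 K c d s - frame_norm2 K' c' d' s) L HL
  (fun s => is_derive_minus _ _ s _ _ (proj1 (proj2 (HD s)))
              (proj1 (proj2 (HD' s)))) E1 0).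
unfold frame_norm2 in E2; rewrite c0, d0, c0', d0' in E2. lra.
Qed.

Lemma is_derive_reflect (f df : R -> R) :
  (forall s, is_derive f s (df s)) ->
  forall s, is_derive (fun x => f (- x)) s (- df (- s)).
Proof.
intros H s; assert (E := Derive_eta _ _ _ (H (- s))).
auto_derive; [eexists; apply H | rewrite E; ring].
Qed.

(** Symmetry together with periodicity would make the reciprocal height even near 0, so its third
    derivative there, [- K1 0], would vanish. *)
Lemma frame_curve_nonsymmetric (L : R) (K K1 a b c d : R -> R) :
  0 < L ->
  (forall s, is_derive K s (K1 s)) -> frame_row K c d ->
  (forall s, c (s + L) = c s /\ d (s + L) = d s) ->
  c 0 = 0 -> d 0 = 1 -> K1 0 <> 0 ->
  ~ symmetric_curve (frame_curve L a b c d).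
Proof.
intros HL HK H Hper c0 d0 HK1 Hsym; apply HK1.
assert (HD := fun s => frame_norm_derive K K1 c d HK H s).
assert (E0 : forall s, 0 <= s <= L / 2 -> frame_norm c d s - frame_norm c d (- s) = 0).
{ intros s Hs.
  assert (Hp : 0 <= L - s <= L) by lra. assert (Hq : 0 <= s <= L) by lra.
  destruct (Hsym (L / 2 - s) (exist _ (L - s) Hp) (exist _ s Hq)) as [_ E];
    simpl; try lra.
  apply (f_equal Rinv) in E; simpl in E; rewrite !Rinv_inv in E.
  unfold frame_norm. rewrite <- E.
  destruct (Hper (- s)) as [E1 E2].
  replace (- s + L) with (L - s) in E1, E2 by ring. rewrite E1, E2; ring. }
assert (HL2 : 0 < L / 2) by lra.
assert (E1 := is_derive_zero_on_interval _
  (fun s => frame_norm1 c d s - - frame_norm1 c d (- s)) _ HL2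
  (fun s => is_derive_minus _ _ s _ _ (proj1 (HD s))
     (is_derive_reflect _ _ (fun s => proj1 (HD s)) s)) E0).
assert (E2 := is_derive_zero_on_interval _
  (fun s => frame_norm2 K c d s - - - frame_norm2 K c d (- s)) _ HL2
  (fun s => is_derive_minus _ _ s _ _ (proj1 (proj2 (HD s)))
     (is_derive_opp _ s _
       (is_derive_reflect _ _ (fun s => proj1 (proj2 (HD s))) s))) E1).
(* The three sign changes leave a sum, whose value at 0 is [- 2 * K1 0]. *)
assert (E3 := is_derive_zero_on_interval _
  (fun s => frame_norm3 K K1 c d s - - - - frame_norm3 K K1 c d (- s)) _ HL2
  (fun s => is_derive_minus _ _ s _ _ (proj2 (proj2 (HD s)))
     (is_derive_opp _ s _ (is_derive_opp _ s _
       (is_derive_reflect _ _ (fun s => proj2 (proj2 (HD s))) s)))) E2 0).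
unfold frame_norm3 in E3; rewrite Ropp_0, c0, d0 in E3. lra.
Qed.

(** * From one closed elastica to uncountably many solutions *)

Lemma closed_frame_uncountable (L T : R) (K K1 a b c d : R -> R) :
  0 < L -> 0 < T ->
  (forall s, is_derive K s (K1 s)) ->
  (forall s, is_derive K1 s (K s - K s ^ 3 / 2)) ->
  frame_row K a b -> frame_row K c d ->
  a 0 * d 0 - b 0 * c 0 <> 0 ->
  (forall s, a (s + L) = a s /\ b (s + L) = b s /\
             c (s + L) = c s /\ d (s + L) = d s) ->
  (forall s, 0 < s < T -> K1 s < 0) ->
  ~ countable (fun C : curve =>
      dirichlet_solution (0, 1) (0, 1) 0 0 C /\ ~ symmetric_curve C).
Proof.
intros HL HT HK HK1 Hab Hcd Hdet0 Hper Hneg [f Hf].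
set (D := a 0 * d 0 - b 0 * c 0) in *.
assert (HD : forall t, a t * d t - b t * c t = D)
  by (intros; apply (frame_det_const K a b c d Hab Hcd)).
(* With [M] the matrix of rows [(a, b)] and [(c, d)], the rows in [cv t] are those of
   [M(t)^(-1) M(t + s)]: the isometry moves the point at [t] to [i], and the determinant becomes
   1. *)
pose (row := fun u v (g h : R -> R) t s => u t / D * g (t + s) + v t / D * h (t + s)).
pose (nb := fun t => - b t). pose (nc := fun t => - c t).
pose (cv := fun t => frame_curve L (row d nb a c t) (row d nb b d t)
                                   (row nc a a c t) (row nc a b d t)).
assert (Hrow : forall u v t,
  frame_row (fun s => K (t + s)) (row u v a c t) (row u v b d t)).
{ intros u v t; apply frame_row_comb; apply (frame_row_shift K); assumption. }
assert (HKt := fun t => is_derive_shift K K1 t HK).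
assert (Hper' : forall t s,
  row d nb a c t (s + L) = row d nb a c t s /\
  row d nb b d t (s + L) = row d nb b d t s /\
  row nc a a c t (s + L) = row nc a a c t s /\
  row nc a b d t (s + L) = row nc a b d t s).
{ intros t s; unfold row; rewrite <- !Rplus_assoc.
  destruct (Hper (t + s)) as (-> & -> & -> & ->); tauto. }
assert (Hid : forall t, row d nb a c t 0 = 1 /\ row d nb b d t 0 = 0 /\
                        row nc a a c t 0 = 0 /\ row nc a b d t 0 = 1).
{ intros t; unfold row, nb, nc; rewrite !Rplus_0_r.
  assert (E : (a t * d t - b t * c t) / D = 1) by (rewrite HD; now field).
  repeat split; try (field; exact Hdet0); rewrite <- E; field; exact Hdet0. }
assert (Hcv : forall t, 0 < t < T ->
  dirichlet_solution (0, 1) (0, 1) 0 0 (cv t) /\ ~ symmetric_curve (cv t)).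
{ intros t Ht; split.
  - apply (frame_curve_dirichlet L (fun s => K (t + s)) (fun s => K1 (t + s)));
      auto.
    + apply (is_derive_shift K1 (fun s => K s - K s ^ 3 / 2)); exact HK1.
    + intros s [-> | ->]; [apply Hid|].
      rewrite <- (Rplus_0_l L). destruct (Hper' t 0) as (-> & -> & -> & ->); apply Hid.
  - apply (frame_curve_nonsymmetric L (fun s => K (t + s)) (fun s => K1 (t + s)));
      auto; try apply Hid.
    + intros s; destruct (Hper' t s); tauto.
    + rewrite Rplus_0_r; specialize (Hneg t Ht); lra. }
assert (Hinj : forall t t', 0 < t < T -> 0 < t' < T -> f (cv t) = f (cv t') -> t = t').
{ intros t t' Ht Ht' E.
  apply Hf in E; [|now apply Hcv|now apply Hcv].
  assert (EK : K t = K t').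
  { rewrite <- (Rplus_0_r t), <- (Rplus_0_r t').
    apply (frame_curve_curvature L _ (fun s => K1 (t + s)) _ _ _ _
             (fun s => K (t' + s)) (fun s => K1 (t' + s)) _ _ _ _ HL
             (HKt t) (HKt t') (Hrow nc a t) (Hrow nc a t')) in E;
      try apply Hid; exact E. }
  (* [K] is strictly decreasing on [(0, T)], so equal curvatures force equal parameters. *)
  destruct (MVT_gen K t t' K1) as [x [Hx E']].
  - intros; apply HK.
  - intros x _; apply continuity_pt_filterlim, (ex_derive_continuous K x).
    eexists; apply HK.
  - assert (0 < x < T).
    { unfold Rmin, Rmax in Hx; destruct (Rle_dec t t'); lra. }
    specialize (Hneg x H). rewrite EK, Rminus_diag in E'.
    symmetry in E'; apply Rmult_integral in E'; destruct E'; lra. }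
(* [u n] is a parameter whose curve has code [n], arbitrary if there is none. By injectivity [u]
   would enumerate [(0, T)]. *)
pose (u := fun n => epsilon (inhabits 0)
  (fun t => 0 < t < T /\ f (cv t) = n)).
destruct (sequence_misses_point u (T / 3) (2 * T / 3)) as [x [Hx Hu]]; [lra|].
assert (Hx' : 0 < x < T) by lra.
apply (Hu (f (cv x))).
destruct (epsilon_spec (inhabits 0) (fun t => 0 < t < T /\ f (cv t) = f (cv x))
  (ex_intro _ x (conj Hx' eq_refl))) as [H1 H2].
exact (Hinj _ _ H1 Hx' H2).
Qed.

(** * The phase flow and the closing condition *)

Lemma is_derive_RInt_0 (f : R -> R) :
  (forall t, continuous f t) -> forall t, is_derive (RInt f 0) t (f t).
Proof.
intros Hf t; apply (is_derive_RInt f (RInt f 0) 0); [|apply Hf].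
apply filter_forall; intros y; apply (@RInt_correct R_CompleteNormedModule).
apply @ex_RInt_continuous; intros; apply Hf.
Qed.

(** Separation of variables: [S] is the time at which the phase reaches a given value and [psi] is
    its inverse. *)
Lemma autonomous_flow (k : R -> R) (M : R) :
  (forall t, continuous k t) -> (forall t, 0 < k t <= M) ->
  exists S psi : R -> R, S 0 = 0 /\ (forall t, is_derive S t (/ k t)) /\
    (forall x y, x < y -> S x < S y) /\
    (forall s, S (psi s) = s) /\ (forall s, is_derive psi s (k (psi s))).
Proof.
intros Hk HkM.
assert (HM : 0 < M) by (specialize (HkM 0); lra).
pose (S := RInt (fun t => / k t) 0).
assert (HS : forall t, is_derive S t (/ k t)).
{ apply is_derive_RInt_0; intros t; apply (continuous_comp k Rinv); [apply Hk|].
  apply continuity_pt_filterlim, continuity_pt_inv.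
  - apply continuity_pt_id.
  - unfold id; specialize (HkM t); lra. }
assert (HSc : continuity S).
{ intros t; apply continuity_pt_filterlim, (ex_derive_continuous S t).
  eexists; apply HS. }
assert (S0 : S 0 = 0) by apply (@RInt_point R_CompleteNormedModule).
assert (Hmvt : forall x y, exists z, Rmin x y <= z <= Rmax x y /\
  y - x = k z * (S y - S x)).
{ intros x y. destruct (MVT_gen S x y (fun t => / k t)) as [z [Hz E]].
  - intros; apply HS.
  - intros; apply HSc.
  - exists z; split; [exact Hz|]. rewrite E; field. specialize (HkM z); lra. }
assert (Hinc : forall x y, x < y -> S x < S y).
{ intros x y Hxy; destruct (Hmvt x y) as [z [_ E]]; specialize (HkM z); nra. }
assert (Hsol : forall s, exists t, S t = s).
{ intros s; pose (N := M * (Rabs s + 1)).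
  assert (Hs := Rabs_pos s). assert (HN : 0 < N) by (unfold N; nra).
  assert (E1 : Rabs s <= S N).
  { destruct (Hmvt 0 N) as [z [_ E]]; rewrite S0 in E.
    specialize (HkM z); assert (0 < S N) by (rewrite <- S0; now apply Hinc).
    unfold N in E; unfold N; nra. }
  assert (E2 : S (- N) <= - Rabs s).
  { destruct (Hmvt (- N) 0) as [z [_ E]]; rewrite S0 in E.
    specialize (HkM z); assert (S (- N) < 0) by (rewrite <- S0; apply Hinc; lra).
    unfold N in E; unfold N; nra. }
  assert (Hs' := Rle_abs s). assert (Hs'' := Rle_abs (- s)). rewrite Rabs_Ropp in Hs''.
  destruct (IVT_gen S (- N) N s HSc) as [t [_ Ht]]; [|now exists t].
  rewrite Rmin_left, Rmax_right; lra. }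
pose (psi := fun s => epsilon (inhabits 0) (fun t => S t = s)).
assert (Hpsi : forall s, S (psi s) = s)
  by (intros s; apply (epsilon_spec (inhabits 0) (fun t => S t = s)), Hsol).
exists S, psi; do 4 (split; [assumption|]).
intros s; apply is_derive_Reals; intros eps Heps.
destruct (proj2 (continuity_pt_filterlim k (psi s)) (Hk (psi s)) eps Heps)
  as [d [Hd Hlim]].
assert (Hdm : 0 < d / M) by now apply Rdiv_lt_0_compat.
exists (mkposreal _ Hdm); simpl; intros h Hh Hhd.
destruct (Hmvt (psi s) (psi (s + h))) as [z [Hz E]]; rewrite !Hpsi in E.
(* The difference quotient is exactly [k z] with [z] between the two phases; these differ by at most
   [M * Rabs h], so continuity of [k] suffices. *)
replace ((psi (s + h) - psi s) / h) with (k z)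
  by (rewrite E; field; exact Hh).
destruct (Req_dec z (psi s)) as [->|Hne].
{ rewrite Rminus_diag, Rabs_R0; exact Heps. }
apply (Hlim z); split; [split; [exact I | now apply not_eq_sym]|].
simpl; unfold R_dist.
apply Rle_lt_trans with (Rabs (psi (s + h) - psi s)).
- unfold Rmin, Rmax in Hz; destruct (Rle_dec (psi s) (psi (s + h)));
    unfold Rabs; destruct (Rcase_abs (z - psi s)), (Rcase_abs (psi (s + h) - psi s)); lra.
- rewrite E, Rabs_mult. specialize (HkM z).
  rewrite (Rabs_pos_eq (k z)) by lra.
  replace (s + h - s) with h by ring.
  apply Rle_lt_trans with (M * Rabs h).
  + apply Rmult_le_compat_r; [apply Rabs_pos | lra].
  + replace d with (M * (d / M)) by (field; lra). now apply Rmult_lt_compat_l.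
Qed.

(* With q = x / w and c = 1 / w, w = sqrt (1 + x^2), the integrand becomes
   1 / (1 + rho) with rho >= 1 defined for all real x, and the intermediate
   value theorem applies between x = 0 and x = 99 / 20. *)
Lemma exists_closing_modulus : exists q c : R,
  0 < q < 1 /\ 0 < c /\ q * q + c * c = 1 /\
  RInt (fun t => c / (sqrt (2 * (1 + q * cos t)) + c)) 0 (2 * PI) = 2 * PI / 3.
Proof.
pose (w := fun x => sqrt (1 + x * x)).
pose (rho := fun x t => sqrt (2 * w x * (w x + x * cos t))).
pose (Theta := fun x => RInt (fun t => / (1 + rho x t)) 0 (2 * PI)).
assert (Hpi := PI_RGT_0).
assert (Hw : forall x, w x * w x = 1 + x * x).
{ intros x; apply sqrt_sqrt; nra. }
assert (Hw0 : forall x, 0 < w x) by (intros x; apply sqrt_lt_R0; nra).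
(* The radicand is [(w + x cos t)^2 + 1 + x^2 sin^2 t]. *)
assert (Hrad : forall x t, 1 <= 2 * w x * (w x + x * cos t)).
{ intros x t; specialize (Hw x); generalize (COS_bound t) (pow2_ge_0 (w x + x * cos t)).
  intros. assert (cos t * cos t <= 1) by nra.
  assert (x * x * (cos t * cos t) <= x * x) by nra. nra. }
assert (Hrho : forall x t, 1 <= rho x t).
{ intros x t; rewrite <- sqrt_1; apply sqrt_le_1_alt, Hrad. }
assert (Hrho2 : forall x t, rho x t * rho x t = 2 * (1 + x * x) + 2 * (x * w x) * cos t).
{ intros x t; unfold rho; rewrite sqrt_sqrt by (specialize (Hrad x t); lra).
  rewrite <- Hw; ring. }
assert (Hex : forall x a b, ex_RInt (fun t => / (1 + rho x t)) a b).
{ intros x a b; apply @ex_RInt_continuous; intros t _.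
  apply @ex_derive_continuous; unfold rho; auto_derive.
  specialize (Hrad x t); specialize (Hrho x t); unfold rho in Hrho. repeat split; lra. }
assert (Hcont : continuity Theta).
{ intros x.
  (* [U] vanishes at [x] and dominates the change of [Theta]: the bound on [rho^2] passes to [rho]
     because [rho >= 1], and [2 * PI] is the length of the interval. *)
  pose (U := fun y => 2 * PI * (2 * Rabs (y * y - x * x) + 2 * Rabs (y * w y - x * w x))).
  assert (HU : continuity_pt U x).
  { assert (forall g : R -> R, ex_derive g x -> continuity_pt (fun y => Rabs (g y)) x).
    { intros g Hg; apply (continuity_pt_comp g Rabs); [|apply Rcontinuity_abs].
      apply continuity_pt_filterlim, (ex_derive_continuous g x), Hg. }
    apply (continuity_pt_scal (fun y => 2 * Rabs (y * y - x * x)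
      + 2 * Rabs (y * w y - x * w x))), (continuity_pt_plus
      (fun y => 2 * Rabs (y * y - x * x)) (fun y => 2 * Rabs (y * w y - x * w x)));
    [apply (continuity_pt_scal (fun y => Rabs (y * y - x * x)))
    |apply (continuity_pt_scal (fun y => Rabs (y * w y - x * w x)))]; apply H.
    - auto_derive; exact I.
    - unfold w; auto_derive; nra. }
  assert (HTU : forall y, Rabs (Theta y - Theta x) <= U y).
  { intros y; unfold Theta.
    rewrite <- (@RInt_minus R_CompleteNormedModule) by apply Hex.
    unfold U; replace (2 * PI) with (2 * PI - 0) at 2 by ring.
    apply abs_RInt_le_const; [lra | apply @ex_RInt_minus; apply Hex |].
    intros t _; unfold minus, plus, opp; simpl.
    assert (Hx := Hrho x t). assert (Hy := Hrho y t).
    assert (E : / (1 + rho y t) + - / (1 + rho x t) =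
      (rho x t - rho y t) * (/ (1 + rho y t) * / (1 + rho x t))) by (field; lra).
    assert (E2 : Rabs (rho x t - rho y t) * (rho x t + rho y t) <=
      2 * Rabs (y * y - x * x) + 2 * Rabs (y * w y - x * w x)).
    { rewrite <- (Rabs_pos_eq (rho x t + rho y t)), <- Rabs_mult by lra.
      replace ((rho x t - rho y t) * (rho x t + rho y t))
        with (rho x t * rho x t - rho y t * rho y t) by ring.
      rewrite !Hrho2.
      assert (Hc : Rabs ((y * w y - x * w x) * cos t) <= Rabs (y * w y - x * w x)).
      { rewrite Rabs_mult. rewrite <- (Rmult_1_r (Rabs (y * w y - x * w x))) at 2.
        apply Rmult_le_compat_l; [apply Rabs_pos|]. apply Rabs_le, COS_bound. }
      revert Hc; unfold Rabs; repeat destruct Rcase_abs; lra. }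
    assert (E3 : / (1 + rho y t) * / (1 + rho x t) <= 1).
    { rewrite <- Rinv_mult, <- Rinv_1. apply Rinv_le_contravar; nra. }
    assert (E4 : 0 < / (1 + rho y t) * / (1 + rho x t))
      by (rewrite <- Rinv_mult; apply Rinv_0_lt_compat; nra).
    rewrite E, Rabs_mult, (Rabs_pos_eq (/ (1 + rho y t) * _)) by lra.
    assert (E5 := Rabs_pos (rho x t - rho y t)). nra. }
  intros eps Heps; destruct (HU eps Heps) as [al [Hal Hlim]].
  exists al; split; [exact Hal|]; intros y Hy; specialize (Hlim y Hy).
  simpl in *; unfold R_dist in *.
  assert (U x = 0) by (unfold U; rewrite !Rminus_diag, Rabs_R0; ring).
  rewrite H, Rminus_0_r in Hlim.
  apply Rle_lt_trans with (U y); [apply HTU|].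
  apply Rle_lt_trans with (Rabs (U y)); [apply Rle_abs | exact Hlim]. }
assert (HT0 : 2 * PI / 3 < Theta 0).
{ unfold Theta.
  rewrite (RInt_ext _ (fun _ => / (1 + sqrt 2))).
  - rewrite RInt_const; unfold scal; simpl; unfold mult; simpl.
    assert (sqrt 2 < 2).
    { rewrite <- (sqrt_square 2) at 2 by lra. apply sqrt_lt_1_alt; lra. }
    assert (0 <= sqrt 2) by apply sqrt_pos.
    assert (/ 3 < / (1 + sqrt 2)) by (apply Rinv_lt_contravar; nra). nra.
  - intros t _; unfold rho, w; do 3 f_equal.
    replace (1 + 0 * 0) with 1 by ring; rewrite sqrt_1; ring. }
(* The triple 20, 99, 101 makes [w] rational. The integrand is at most [1/8] where the cosine is
   nonnegative and at most [1/2] elsewhere, which gives [5 PI / 8 < 2 PI / 3]. *)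
assert (HT1 : Theta (99 / 20) <= 5 * PI / 8).
{ assert (w1 : w (99 / 20) = 101 / 20).
  { unfold w; replace (1 + 99 / 20 * (99 / 20)) with (101 / 20 * (101 / 20)) by field.
    apply sqrt_square; lra. }
  assert (Hb : forall t, / (1 + rho (99 / 20) t) <= / 2).
  { intros t; specialize (Hrho (99 / 20) t); apply Rinv_le_contravar; lra. }
  assert (Hs : forall t, 0 <= cos t -> / (1 + rho (99 / 20) t) <= / 8).
  { intros t Ht; apply Rinv_le_contravar; [lra|].
    assert (7 <= rho (99 / 20) t); [|lra].
    rewrite <- (sqrt_square 7) by lra. apply sqrt_le_1_alt; rewrite w1; lra. }
  assert (Hle : forall a b m, a <= b ->
    (forall t, a < t < b -> / (1 + rho (99 / 20) t) <= m) ->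
    RInt (fun t => / (1 + rho (99 / 20) t)) a b <= (b - a) * m).
  { intros a b m Hab Hm.
    apply Rle_trans with (RInt (fun _ => m) a b).
    - apply RInt_le; auto. apply ex_RInt_const.
    - rewrite RInt_const; apply Rle_refl. }
  unfold Theta.
  rewrite <- (RInt_Chasles _ 0 (PI / 2)), <- (RInt_Chasles _ (PI / 2) (3 * (PI / 2)))
    by apply Hex.
  unfold plus; simpl.
  assert (I1 := Hle 0 (PI / 2) (/ 8)).
  assert (I2 := Hle (PI / 2) (3 * (PI / 2)) (/ 2)).
  assert (I3 := Hle (3 * (PI / 2)) (2 * PI) (/ 8)).
  specialize (I1 ltac:(lra) (fun t Ht => Hs t (cos_ge_0 t ltac:(lra) ltac:(lra)))).
  specialize (I2 ltac:(lra) (fun t Ht => Hb t)).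
  specialize (I3 ltac:(lra) (fun t Ht => Hs t (cos_ge_0_3PI2 t ltac:(lra) ltac:(lra)))).
  lra. }
destruct (IVT_gen Theta 0 (99 / 20) (2 * PI / 3) Hcont) as [x [Hx E]].
{ rewrite Rmin_right, Rmax_left; lra. }
rewrite Rmin_left, Rmax_right in Hx by lra.
assert (Hx0 : 0 < x).
{ destruct (Req_dec x 0) as [->|]; lra. }
assert (Hwx := Hw x). assert (Hwx0 := Hw0 x).
exists (x / w x), (/ w x).
assert (Hxw : x < w x) by nra.
split; [split|split; [|split]].
- now apply Rdiv_lt_0_compat.
- apply (Rmult_lt_reg_r (w x)); [lra|]. unfold Rdiv; rewrite Rmult_assoc, Rinv_l; lra.
- now apply Rinv_0_lt_compat.
- transitivity ((1 + x * x) / (w x * w x)); [field; lra | rewrite Hwx; field; nra].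
- assert (Ef : forall t,
    / w x / (sqrt (2 * (1 + x / w x * cos t)) + / w x) = / (1 + rho x t)).
  { intros t; assert (Er : rho x t = w x * sqrt (2 * (1 + x / w x * cos t))).
    { unfold rho. rewrite <- (sqrt_square (w x)) at 3 by lra.
      rewrite <- sqrt_mult_alt by nra. apply (f_equal sqrt); field; lra. }
    specialize (Hrho x t). rewrite Er in Hrho |- *. field. lra. }
  rewrite <- E; apply RInt_ext; intros t _; apply Ef.
Qed.

(** * An explicit frame for a given elastica *)

(* In terms of the complex functions u = c + i d and v = c - i d, the equation of
   a frame row (c, d), extended to complex-valued rows, reads
   u' = i/2 (K u + v), v' = - i/2 (u + K v).  For an elastica with energy
   constant - c^2 it has the solution u = h e^(i om), v = m e^(i om) / h with
   m = - K^2 / 2 - i K' and h^2 = K + c; the real and imaginary parts of the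
   corresponding row are two real frame rows. *)
Section OrbitlikeFrame.

Variables (K K1 h om : R -> R) (c : R).
Hypothesis HK : forall s, is_derive K s (K1 s).
Hypothesis HK1 : forall s, is_derive K1 s (K s - K s ^ 3 / 2).
Hypothesis Henergy : forall s, K1 s * K1 s = K s ^ 2 - K s ^ 4 / 4 - c ^ 2.
Hypothesis Hh : forall s, is_derive h s (K1 s / (2 * h s)).
Hypothesis Hh0 : forall s, 0 < h s.
Hypothesis Hh2 : forall s, c = h s * h s - K s.
Hypothesis Hom : forall s,
  is_derive om s (K s * (K s + 2 * c) / (4 * (K s + c))).

Definition U1 s := h s * cos (om s).
Definition U2 s := h s * sin (om s).
Definition V1 s := (- (K s * K s) / 2 * cos (om s) + K1 s * sin (om s)) / h s.
Definition V2 s := (- (K s * K s) / 2 * sin (om s) - K1 s * cos (om s)) / h s.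

Lemma spinor_derive s :
  is_derive U1 s (- / 2 * (K s * U2 s + V2 s)) /\
  is_derive U2 s (/ 2 * (K s * U1 s + V1 s)) /\
  is_derive V1 s (/ 2 * (U2 s + K s * V2 s)) /\
  is_derive V2 s (- / 2 * (U1 s + K s * V1 s)).
Proof.
assert (h0 := Hh0 s). assert (hc := Hh2 s). assert (He := Henergy s).
assert (HomK : is_derive om s (K s * (2 * (h s * h s) - K s) / (4 * (h s * h s)))).
{ evar_last; [apply Hom|].
  replace (K s + c) with (h s * h s) by lra.
  replace (K s + 2 * c) with (2 * (h s * h s) - K s) by lra. reflexivity. }
assert (E1 := Derive_eta _ _ _ (HK s)). assert (E2 := Derive_eta _ _ _ (HK1 s)).
assert (E3 := Derive_eta _ _ _ (Hh s)). assert (E4 := Derive_eta _ _ _ HomK).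
assert (X1 : ex_derive K s) by (eexists; apply HK).
assert (X2 : ex_derive K1 s) by (eexists; apply HK1).
assert (X3 : ex_derive h s) by (eexists; apply Hh).
assert (X4 : ex_derive om s) by (eexists; apply HomK).
assert (He' : K1 s * K1 s - (K s ^ 2 - K s ^ 4 / 4 - (h s * h s - K s) ^ 2) = 0)
  by (rewrite <- hc, He; ring).
unfold U1, U2, V1, V2.
split; [|split; [|split]]; (auto_derive; [repeat split; auto; lra|]);
  rewrite ?E1, ?E2, ?E3, ?E4.
- field; lra.
- field; lra.
(* The equations for [v] hold only modulo the energy identity; the two sides differ by a multiple of
   [He']. *)
- apply Rminus_diag_uniq.
  transitivity (- sin (om s) / (2 * h s ^ 3) *
    (K1 s * K1 s - (K s ^ 2 - K s ^ 4 / 4 - (h s * h s - K s) ^ 2)));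
    [field; lra | rewrite He'; ring].
- apply Rminus_diag_uniq.
  transitivity (cos (om s) / (2 * h s ^ 3) *
    (K1 s * K1 s - (K s ^ 2 - K s ^ 4 / 4 - (h s * h s - K s) ^ 2)));
    [field; lra | rewrite He'; ring].
Qed.

(** Up to a factor 2, [c = u + v] and [d = - i (u - v)]; the two rows are the real and imaginary
    parts. *)
Lemma spinor_frame :
  frame_row K (fun s => U1 s + V1 s) (fun s => U2 s - V2 s) /\
  frame_row K (fun s => U2 s + V2 s) (fun s => V1 s - U1 s).
Proof.
split; intros s; destruct (spinor_derive s) as (D1 & D2 & D3 & D4);
  split; (auto_derive; [repeat split; eexists; eassumption |]);
  rewrite ?(Derive_eta _ _ _ D1), ?(Derive_eta _ _ _ D2),
    ?(Derive_eta _ _ _ D3), ?(Derive_eta _ _ _ D4); field.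
Qed.

(** The determinant is [|v|^2 - |u|^2], where [|u|^2 = K + c] and the energy identity gives
    [|v|^2 = (K^2 - c^2) / (K + c) = K - c]. *)
Lemma spinor_det s :
  (U1 s + V1 s) * (V1 s - U1 s) - (U2 s - V2 s) * (U2 s + V2 s) = - 2 * c.
Proof.
assert (h0 := Hh0 s). assert (hc := Hh2 s). assert (He := Henergy s).
assert (Hcs : cos (om s) * cos (om s) + sin (om s) * sin (om s) = 1)
  by (generalize (sin2_cos2 (om s)); unfold Rsqr; lra).
transitivity ((cos (om s) * cos (om s) + sin (om s) * sin (om s)) *
  ((K s ^ 4 / 4 + K1 s * K1 s) / (h s * h s) - h s * h s)).
- unfold U1, U2, V1, V2; field; lra.
- rewrite Hcs, He, hc; field; lra.
Qed.

End OrbitlikeFrame.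

(** * Closing up after three periods of the curvature *)

Lemma is_derive_periodic_increment (f df : R -> R) (p : R) :
  (forall t, is_derive f t (df t)) -> (forall t, df (t + p) = df t) ->
  forall t, f (t + p) = f t + (f p - f 0).
Proof.
intros Hf Hp t.
assert (E : f (t + p) - f t = f (0 + p) - f 0); [|rewrite Rplus_0_l in E; lra].
apply (is_derive_zero_const (fun t => f (t + p) - f t)); clear t; intros t.
auto_derive; [repeat split; eexists; apply Hf|].
rewrite (Derive_eta _ _ _ (Hf t)), (Derive_eta _ _ _ (Hf (t + p))), Hp; ring.
Qed.

Lemma closed_frame_exists : exists (L T : R) (K K1 a b c d : R -> R),
  0 < L /\ 0 < T /\
  (forall s, is_derive K s (K1 s)) /\
  (forall s, is_derive K1 s (K s - K s ^ 3 / 2)) /\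
  frame_row K a b /\ frame_row K c d /\
  a 0 * d 0 - b 0 * c 0 <> 0 /\
  (forall s, a (s + L) = a s /\ b (s + L) = b s /\
             c (s + L) = c s /\ d (s + L) = d s) /\
  (forall s, 0 < s < T -> K1 s < 0).
Proof.
destruct exists_closing_modulus as (q & c & Hq & Hc & Hqc & Hint).
assert (Hpi := PI_RGT_0).
pose (k := fun t => sqrt (2 * (1 + q * cos t))).
assert (Hrad : forall t, 0 < 2 * (1 + q * cos t) <= 4)
  by (intros t; generalize (COS_bound t); nra).
assert (Hk2 : forall t, k t * k t = 2 * (1 + q * cos t))
  by (intros t; apply sqrt_sqrt; specialize (Hrad t); lra).
assert (Hk : forall t, 0 < k t <= 2).
{ intros t; split; [apply sqrt_lt_R0, Hrad|].
  rewrite <- (sqrt_square 2) by lra. apply sqrt_le_1_alt; specialize (Hrad t); lra. }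
assert (Dk : forall t, is_derive k t (- q * sin t / k t)).
{ intros t; specialize (Hrad t); specialize (Hk t); unfold k in Hk |- *.
  auto_derive; [lra | field; lra]. }
assert (Hkper : forall t, k (t + 2 * PI) = k t)
  by (intros t; unfold k; rewrite cos_plus, cos_2PI, sin_2PI; apply (f_equal sqrt); ring).
assert (Ck : forall t, continuous k t)
  by (intros t; apply @ex_derive_continuous; eexists; apply Dk).
destruct (autonomous_flow k 2 Ck Hk) as (S & psi & S0 & DS & Sinc & HSpsi & Dpsi).
(* The derivative of [om] with respect to the phase: [(k + 2c) / (4 (k + c))]. *)
pose (dw := fun t => (1 + c / (k t + c)) / 4).
assert (Cdw : forall t, continuous dw t).
{ intros t; apply @ex_derive_continuous; unfold dw.
  specialize (Hk t); auto_derive; repeat split; [eexists; apply Dk | lra]. }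
pose (w := RInt dw 0 : R -> R).
assert (Dw : forall t, is_derive w t (dw t)) by now apply is_derive_RInt_0.
assert (Hw0 : w 0 = 0) by apply (@RInt_point R_CompleteNormedModule).
(* The choice of modulus gives [(2 PI + 2 PI / 3) / 4], half of the turning angle [4 PI / 3] since
   the frame acts on the plane with doubled angle. *)
assert (Hw2pi : w (2 * PI) = 2 * PI / 3).
{ assert (Cf : forall t, continuous (fun t => c / (k t + c)) t).
  { intros t; apply @ex_derive_continuous.
    specialize (Hk t); auto_derive; repeat split; [eexists; apply Dk | lra]. }
  assert (Ef : ex_RInt (fun t => c / (k t + c)) 0 (2 * PI))
    by (apply @ex_RInt_continuous; intros; apply Cf).
  assert (Ei := is_RInt_scal _ _ _ (/ 4) _
    (is_RInt_plus _ _ _ _ _ _ (is_RInt_const 0 (2 * PI) 1)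
      (@RInt_correct R_CompleteNormedModule _ _ _ Ef))).
  apply (is_RInt_ext _ dw) in Ei.
  - unfold w; rewrite (is_RInt_unique _ _ _ _ Ei).
    rewrite (Hint : RInt (fun t => c / (k t + c)) 0 (2 * PI) = 2 * PI / 3).
    unfold scal, plus; simpl; unfold mult; simpl; field.
  - intros t _. transitivity (/ 4 * (1 + c / (k t + c)) : R); [reflexivity|].
    apply Rmult_comm. }
assert (Hwper : forall t, w (t + 2 * PI) = w t + 2 * PI / 3).
{ intros t; rewrite (is_derive_periodic_increment w dw), Hw0, Hw2pi; auto; [ring|].
  intros; unfold dw; now rewrite Hkper. }
assert (HSper : forall t, S (t + 2 * PI) = S t + S (2 * PI)).
{ intros t; rewrite (is_derive_periodic_increment S (fun t => / k t)), S0; auto; [ring|].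
  intros; now rewrite Hkper. }
assert (Sinj : forall x y, S x = S y -> x = y).
{ intros x y E; destruct (Rtotal_order x y) as [H|[H|H]]; auto;
    apply Sinc in H; lra. }
pose (T := S (2 * PI)).
assert (Hpsiper : forall s, psi (s + T) = psi s + 2 * PI).
{ intros s; apply Sinj; rewrite HSper, !HSpsi; reflexivity. }
pose (K := fun s => k (psi s)). pose (K1 := fun s => - q * sin (psi s)).
pose (h := fun s => sqrt (K s + c)). pose (om := fun s => w (psi s)).
assert (HK0 : forall s, 0 < K s) by (intros; apply Hk).
assert (HKsq : forall s, K s * K s = 2 * (1 + q * cos (psi s))) by (intros; apply Hk2).
assert (DK : forall s, is_derive K s (K1 s)).
{ intros s; evar_last; [apply (is_derive_comp k psi); [apply Dk | apply Dpsi]|].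
  unfold scal; simpl; unfold mult; simpl; unfold K1. field.
  specialize (HK0 s); unfold K in HK0; lra. }
assert (DK1 : forall s, is_derive K1 s (K s - K s ^ 3 / 2)).
{ intros s; unfold K1; auto_derive; [eexists; apply Dpsi|].
  rewrite (Derive_eta _ _ _ (Dpsi s)). change (k (psi s)) with (K s).
  transitivity (K s * (1 - (2 * (1 + q * cos (psi s))) / 2));
    [field | rewrite <- HKsq; field]. }
assert (Hen : forall s, K1 s * K1 s = K s ^ 2 - K s ^ 4 / 4 - c ^ 2).
{ intros s; replace (K s ^ 2) with (K s * K s) by ring.
  replace (K s ^ 4) with ((K s * K s) * (K s * K s)) by ring. rewrite HKsq.
  unfold K1. generalize (sin2_cos2 (psi s)); unfold Rsqr; intros E.
  transitivity (q * q * (sin (psi s) * sin (psi s))); [ring|].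
  replace (sin (psi s) * sin (psi s)) with (1 - cos (psi s) * cos (psi s)) by lra.
  replace (c ^ 2) with (1 - q * q) by (rewrite <- Hqc; ring). field. }
assert (Hh2 : forall s, h s * h s = K s + c)
  by (intros s; apply sqrt_sqrt; specialize (HK0 s); lra).
assert (Hh0 : forall s, 0 < h s)
  by (intros s; apply sqrt_lt_R0; specialize (HK0 s); lra).
assert (Dh : forall s, is_derive h s (K1 s / (2 * h s))).
{ intros s; specialize (HK0 s); specialize (Hh0 s); unfold h in Hh0 |- *.
  auto_derive; [repeat split; [eexists; apply DK | lra]|].
  rewrite (Derive_eta _ _ _ (DK s)); field; lra. }
assert (Dom : forall s, is_derive om s (K s * (K s + 2 * c) / (4 * (K s + c)))).
{ intros s; evar_last; [apply (is_derive_comp w psi); [apply Dw | apply Dpsi]|].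
  unfold scal; simpl; unfold mult; simpl; unfold dw; change (k (psi s)) with (K s). field.
  specialize (HK0 s); lra. }
assert (Hhc : forall s, c = h s * h s - K s) by (intros s; rewrite Hh2; ring).
destruct (spinor_frame K K1 h om c DK DK1 Hen Dh Hh0 Hhc Dom) as [F1 F2].
(* On [(0, S PI)] the phase runs through [(0, PI)], where the sine is positive and the curvature
   decreases. *)
exists (3 * T), (S PI), K, K1. do 4 eexists.
split; [|split; [|split; [exact DK|split; [exact DK1|split; [exact F1
  |split; [exact F2|split; [|split]]]]]]].
- unfold T; rewrite <- S0; assert (S 0 < S (2 * PI)) by (apply Sinc; lra). lra.
- rewrite <- S0; apply Sinc; lra.
- simpl. rewrite (spinor_det K K1 h om c); auto; lra.
- intros s.
  assert (Epsi : psi (s + 3 * T) = psi s + 2 * PI + 2 * PI + 2 * PI).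
  { replace (s + 3 * T) with (s + T + T + T) by ring. now rewrite !Hpsiper. }
  assert (EK : K (s + 3 * T) = K s) by (unfold K; now rewrite Epsi, !Hkper).
  assert (EK1 : K1 (s + 3 * T) = K1 s).
  { unfold K1; rewrite Epsi, !sin_plus, !cos_plus, cos_2PI, sin_2PI; ring. }
  assert (Eh : h (s + 3 * T) = h s) by (unfold h; now rewrite EK).
  (* A full turn of [om] closes the frame itself, not merely up to sign. *)
  assert (Eom : om (s + 3 * T) = om s + 2 * PI).
  { unfold om; rewrite Epsi, !Hwper; field. }
  unfold U1, U2, V1, V2.
  rewrite EK, EK1, Eh, Eom, sin_plus, cos_plus, cos_2PI, sin_2PI.
  repeat split; field; specialize (Hh0 s); lra.
- intros s Hs; unfold K1.
  assert (Hp : 0 < psi s < PI).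
  { split.
    - destruct (Rle_or_lt (psi s) 0) as [[H|H]|H]; auto.
      + apply Sinc in H; rewrite HSpsi in H; lra.
      + apply (f_equal S) in H; rewrite HSpsi in H; lra.
    - destruct (Rle_or_lt PI (psi s)) as [[H|H]|H]; auto.
      + apply Sinc in H; rewrite HSpsi in H; lra.
      + apply (f_equal S) in H; rewrite HSpsi in H; lra. }
  assert (0 < sin (psi s)) by (apply sin_gt_0; apply Hp). nra.
Qed.

Theorem theorem3 :
  exists A1 A2 B1 B2 phiA phiB : R,
    A1 = - B1 /\ A2 = B2 /\ 0 < B2 /\ phiA = - phiB /\
    ~ countable (fun c : curve =>
        dirichlet_solution (A1, A2) (B1, B2) phiA phiB c /\
        ~ symmetric_curve c).
Proof.
destruct closed_frame_exists
  as (L & T & K & K1 & a & b & c & d & HL & HT & HK & HK1 & Hab & Hcd & H).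
exists 0, 1, 0, 1, 0, 0.
split; [ring | split; [reflexivity | split; [exact Rlt_0_1 | split; [ring|]]]].
apply (closed_frame_uncountable L T K K1 a b c d); tauto.
Qed.
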